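(* Let $p$ be a prime and let $L:\mathbb{F}_p^3\rightarrow\mathbb{F}_p^2$ be the linear map $L(x,y,z)=(x+z,y+z)$. Let $X,Y,Z\subseteq\mathbb{F}_p$ be sets of size $k$, where $k\ge\frac{p+1}{2}$. Then $$|L(X,Y,Z)|\ \ge\ \min\big(p^2+3k^2-(2p+1)k,\ p^2\big).$$
   Context: $L(X,Y,Z)$ denotes the image of $X\times Y\times Z$ under $L$. *)

(* Defs.v *)
From mathcomp Require Import all_boot all_order all_algebra.

Set Implicit Arguments.
Unset Strict Implicit.
Unset Printing Implicit Defensive.

Import Order.TTheory GRing.Theory Num.Theory.
Local Open Scope ring_scope.

(* F_p^3 and F_p^2 are the types 'F_p * 'F_p * 'F_p and 'F_p * 'F_p; their
   coordinatewise module structure is carried by the regular module ('F_p)^o. *)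
Definition L (p : nat) (v : 'F_p * 'F_p * 'F_p) : 'F_p * 'F_p :=
  let: (x, y, z) := v in (x + z, y + z).

Fact L_is_linear (p : nat) :
  linear (@L p : ('F_p)^o * ('F_p)^o * ('F_p)^o -> ('F_p)^o * ('F_p)^o).
Proof.
move=> a [[x y] z] [[x' y'] z'].
by congr pair; rewrite /= scalerDr addrACA.
Qed.

Definition Limage (p : nat) (X Y Z : {set 'F_p}) : {set 'F_p * 'F_p} :=
  @L p @: setX (setX X Y) Z.

(* Main.v *)
Require Import Defs.
From mathcomp Require Import all_boot all_order all_algebra.
From mathcomp Require Import zify.

Import Order.TTheory GRing.Theory Num.Theory.
Local Open Scope ring_scope.

(** For each u, the fibre of the image over u is the sumset A_u + Y with
    A_u = Z ∩ (u - X), and A_u is nonempty because 2k > p. Cauchy-Davenport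
    bounds this fibre below by k - 1 + min(p + 1 - k, |A_u|). As |A_u| is the
    number of representations of u in Z + X, Pollard's theorem with threshold
    t = p + 1 - k <= k bounds the sum over u below by
    p (k - 1) + t min(p, 2k - t). If 3k > 2p this is p^2; otherwise it is
    p^2 - t (2p + 1 - 3k) >= p^2 - k (2p + 1 - 3k). Cauchy-Davenport is
    Pollard's theorem with threshold 1, and Pollard's theorem follows by
    induction on |B|, replacing (A, B) by (A ∪ B, A ∩ B) and (A \ B, B \ A)
    after a translation of B. *)

Definition rep {V : finZmodType} (A B : {set V}) (x : V) : nat :=
  #|[set a in A | x - a \in B]|.

Section Representations.
Context {V : finZmodType}.
Implicit Types (A B : {set V}) (x e : V).

Lemma repE A B x : rep A B x = (\sum_a ((a \in A) && (x - a \in B)%R))%N.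
Proof.
rewrite /rep -sum1_card big_mkcond /=.
by apply: eq_bigr => a _; rewrite inE; case: (_ && _).
Qed.

Lemma rep_le_cardr A B x : (rep A B x <= #|B|)%N.
Proof.
rewrite /rep -(card_imset [set a in A | x - a \in B] (inv_inj (subKr x))).
by apply/subset_leq_card/subsetP => _ /imsetP[a + ->]; rewrite inE => /andP[].
Qed.

(** Inclusion-exclusion for [A] and [x - B], whose common points [rep A B x] counts. *)
Lemma rep_ge A B x : (#|A| + #|B| <= #|V| + rep A B x)%N.
Proof.
have -> : #|B| = #|[set a | x - a \in B]|.
  rewrite -(card_imset _ (inv_inj (subKr x))); congr #|pred_of_set _|.
  apply/setP => a; rewrite inE; apply/imsetP/idP => [[b bB ->]|aB].
    by rewrite subKr.
  by exists (x - a); rewrite ?subKr.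
have -> : rep A B x = #|A :&: [set a | x - a \in B]|.
  by congr #|pred_of_set _|; apply/setP => a; rewrite !inE.
by rewrite -cardsUI leq_add2r max_card.
Qed.

Lemma sum_rep A B : (\sum_(x : V) rep A B x = #|A| * #|B|)%N.
Proof.
under eq_bigr do rewrite repE.
rewrite exchange_big /= -sum_nat_const [RHS]big_mkcond /=.
apply: eq_bigr => a _; case: (a \in A) => /=; last by rewrite big1.
rewrite (reindex_inj (addIr a)) /= -sum1_card [RHS]big_mkcond /=.
by apply: eq_bigr => x _; rewrite addrK; case: (x \in B).
Qed.

Lemma rep_translate A B e x :
  rep A [set b | b - e \in B] (x + e) = rep A B x.
Proof. by apply: eq_card => a; rewrite !inE addrAC addrK. Qed.

(* The pairs (a, b) in A x B and in (A ∪ B) x (A ∩ B) with a + b = x differ,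
   outside (A \ B) x (B \ A), only by exchanging a and b. *)
Lemma rep_setUI A B x :
  rep A B x =
    (rep (A :|: B) (A :&: B) x + rep (A :\: B) (B :\: A) x)%N.
Proof.
rewrite !repE -big_split /=.
pose f a : nat := (a \in A :&: B) && (x - a \in B :\: A).
pose g a : nat := (a \in A) && (x - a \in A :&: B).
pose d a : nat := (a \in A :\: B) && (x - a \in B :\: A).
transitivity (\sum_a (f a + (g a + d a)))%N.
  apply: eq_bigr => a _; rewrite /f /g /d !inE.
  by case: (a \in A); case: (a \in B); case: (x - a \in A); case: (x - a \in B).
rewrite big_split /= (reindex_inj (inv_inj (subKr x))) /= -big_split /=.
apply: eq_bigr => a _; rewrite /f /g /d !inE subKr.
by case: (a \in A); case: (a \in B); case: (x - a \in A); case: (x - a \in B).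
Qed.

Lemma pollard_step A B (t : nat) :
  (forall (A' B' : {set V}) (t' : nat), (#|B'| < #|B|)%N ->
     (t' <= #|A'|)%N -> (t' <= #|B'|)%N ->
     (t' * minn #|V| (#|A'| + #|B'| - t')
        <= \sum_(x : V) minn t' (rep A' B' x))%N) ->
  A :&: B != set0 -> ~~ (B \subset A) -> (t <= #|A|)%N -> (t <= #|B|)%N ->
  (t * minn #|V| (#|A| + #|B| - t) <= \sum_(x : V) minn t (rep A B x))%N.
Proof.
move=> IH0 AB0 nBA tA tB.
under eq_bigr do rewrite rep_setUI.
have cI : (#|A :&: B| < #|B|)%N.
  by rewrite proper_card // properE subsetIr subsetI subxx andbT.
have I0 : (0 < #|A :&: B|)%N by rewrite card_gt0.
have cU := cardsUI A B; have mU : (#|A :|: B| <= #|V|)%N := max_card _.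
have cA := cardsID B A; have cB := cardsID A B.
rewrite setIC in cB.
(* If [t <= #|A :&: B|], the pair of union and intersection suffices: its sizes have the same
   sum. *)
have [tI|It] := leqP t #|A :&: B|.
  have := IH0 (A :|: B) (A :&: B) t; rewrite cU => IH.
  apply: leq_trans (IH _ _ _) _; [by lia..|].
  apply: leq_sum => x _.
  by rewrite leq_min geq_minl (leq_trans (geq_minr _ _) (leq_addr _ _)).
(* Otherwise the counts for this pair stay below [t], so they sum untruncated to the product of its
   sizes, and the differences keep the threshold [t - #|A :&: B|]. *)
have le_sum : (#|A :|: B| * #|A :&: B| +
   \sum_x minn (t - #|A :&: B|) (rep (A :\: B) (B :\: A) x) <=
   \sum_x minn t (rep (A :|: B) (A :&: B) x + rep (A :\: B) (B :\: A) x))%N.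
  rewrite -sum_rep -big_split /=; apply: leq_sum => x _.
  have truncD (i r s : nat) :
      (i < t -> s <= i -> s + minn (t - i) r <= minn t (s + r))%N by lia.
  exact: truncD It (rep_le_cardr _ _ _).
apply: leq_trans le_sum.
have IH := IH0 (A :\: B) (B :\: A) (t - #|A :&: B|)%N
  ltac:(lia) ltac:(lia) ltac:(lia).
apply: leq_trans (leq_add (leqnn _) IH).
(* As [#|A :|: B| <= #|V|], the minimum on the right is its second argument, and the right side
   equals [t * (#|A| + #|B| - t)]. *)
nia.
Qed.

End Representations.

(** Any nonzero [d] generates the additive group of the prime field. *)
Lemma Fp_translate_closed {p} (A : {set 'F_p}) (d : 'F_p) :
  A != set0 -> d != 0 -> {in A, forall a, a + d \in A} -> A = setT.
Proof.
move=> /set0Pn[a aA] d0 cl; apply/setP => x; rewrite inE.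
have clM n : a + d *+ n \in A.
  by elim: n => [|n IH]; rewrite ?addr0 // mulrSr addrA; apply: cl.
suff -> : x = a + d *+ ((x - a) / d) by exact: clM.
by rewrite -mulr_natr natr_Zp mulrCA divff // mulr1 addrC subrK.
Qed.

Lemma pollard {p} (A B : {set 'F_p}) (t : nat) :
  (t <= #|A|)%N -> (t <= #|B|)%N ->
  (t * minn #|'F_p| (#|A| + #|B| - t) <= \sum_x minn t (rep A B x))%N.
Proof.
have [n] := ubnP #|B|; elim: n A B t => // n IHn A B t ltBn tA tB.
have [->|t0] := posnP t; first by rewrite mul0n.
have [/existsP[e /andP[ABe0 nBA]]|] :=
    boolP [exists e, (A :&: [set b | b - e \in B] != set0)
                     && ~~ ([set b | b - e \in B] \subset A)].
  have -> : (\sum_x minn t (rep A B x)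
      = \sum_x minn t (rep A [set b | (b - e)%R \in B] x))%N.
    rewrite [RHS](reindex_inj (addIr e)) /=.
    by apply: eq_bigr => x _; rewrite rep_translate.
  have cB : #|[set b | b - e \in B]| = #|B|.
    by rewrite -[RHS](card_preimset B (addIr (- e))).
  rewrite -cB; apply: pollard_step; rewrite ?cB // => A' B' t' ltB'.
  by apply: IHn; apply: leq_trans ltB' _.
rewrite negb_exists => /forallP noe.
have A0 : A != set0 by rewrite -card_gt0; lia.
(* Every translate of [B] meeting [A] now lies in [A]; the shift by [a - b] takes [b] to [a] and [c]
   to [a + (c - b)]. *)
have cl : {in B &, forall b c, {in A, forall a, a + (c - b) \in A}}.
  move=> b c bB cB a aA; have := noe (a - b).
  rewrite negb_and !negbK => /orP[/eqP/setP/(_ a)|/subsetP/(_ (a + (c - b)))].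
    by rewrite !inE aA subKr bB.
  by rewrite inE opprB [_ + (b - a)]addrC addrA subrK addrC subrK => ->.
have [B1|B1] := leqP #|B| 1.
  have -> : t = #|B| by lia.
  rewrite addnK mulnC.
  have -> : (\sum_x minn #|B| (rep A B x) = #|A| * #|B|)%N.
    by rewrite -sum_rep; apply: eq_bigr => x _; apply/minn_idPr/rep_le_cardr.
  by rewrite leq_mul2r geq_minr orbT.
have [b [c [bB cB bc]]] := card_gt1P B1.
have AT : A = setT.
  apply: (Fp_translate_closed _ (c - b)) => //; first by rewrite subr_eq0 eq_sym.
  exact: cl.
(* With [A] the whole field, every [x] has at least [#|B| >= t] representations. *)
apply: (@leq_trans (\sum_(x : 'F_p) t)%N).
  by rewrite sum_nat_const mulnC leq_mul2r geq_minl orbT.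
apply: leq_sum => x _; rewrite leq_min leqnn /=.
by have := rep_ge A B x; rewrite AT cardsT leq_add2l; apply: leq_trans.
Qed.

Lemma card_fibers (I J : finType) (S : {set I * J}) :
  #|S| = (\sum_i #|[set j | (i, j) \in S]|)%N.
Proof.
transitivity (\sum_i \sum_j ((i, j) \in S))%N.
  rewrite pair_big -sum1_card big_mkcond /=.
  by apply: eq_bigr => -[i j] _ /=; case: (_ \in S).
apply: eq_bigr => i _; rewrite -sum1_card [RHS]big_mkcond /=.
by apply: eq_bigr => j _; rewrite inE; case: (_ \in S).
Qed.

Lemma cauchy_davenport {p} (A B : {set 'F_p}) :
  (0 < #|A|)%N -> (0 < #|B|)%N ->
  (minn #|'F_p| (#|A| + #|B| - 1) <= #|[set x | (0 < rep A B x)%N]|)%N.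
Proof.
move=> A0 B0; have := pollard A B 1 A0 B0; rewrite mul1n => /leq_trans; apply.
rewrite -sum1_card [leqRHS]big_mkcond /=; apply: leq_sum => x _.
by rewrite inE; case: (rep A B x) => [|r]; rewrite ?minn0 ?geq_minl.
Qed.

Lemma Limage_fiber {p} (X Y Z : {set 'F_p}) u :
  [set v | (u, v) \in Limage X Y Z]
    = [set v | (0 < rep [set z in Z | (u - z)%R \in X] Y v)%N].
Proof.
apply/setP => v; rewrite !inE; apply/imsetP/card_gt0P.
  move=> [[[x y] z]]; rewrite !inE /= => /andP[/andP[xX yY] zZ] [-> ->].
  by exists z; rewrite !inE !addrK zZ xX.
move=> [z]; rewrite !inE => /andP[/andP[zZ uX] vY].
by exists (u - z, v - z, z); rewrite ?inE /= ?uX ?vY // !subrK.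
Qed.

Theorem theorem4 (p k : nat) (X Y Z : {set 'F_p}) :
  prime p ->
  #|X| = k -> #|Y| = k -> #|Z| = k ->
  (p + 1 <= 2 * k)%N ->
  (#|Limage X Y Z|%:Z >=
     Num.min (p%:Z ^+ 2 + 3 * k%:Z ^+ 2 - (2 * p%:Z + 1) * k%:Z) (p%:Z ^+ 2)).
Proof.
move=> p_pr cX cY cZ pk; have cF := card_Fp p_pr.
have kp : (k <= p)%N by rewrite -cX; apply: leq_trans (max_card _) _; rewrite cF.
(* Since [k - 1 + (p + 1 - k) = p], the cap [p] in Cauchy-Davenport becomes a truncation of
   [rep Z X u] at [p + 1 - k], the threshold for Pollard's theorem. *)
have fiber_ge u : (k - 1 + minn (p + 1 - k) (rep Z X u)
    <= #|[set v | (u, v) \in Limage X Y Z]|)%N.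
  have r0 : (0 < rep Z X u)%N by have := rep_ge Z X u; rewrite cX cZ cF; lia.
  rewrite Limage_fiber; apply: leq_trans (cauchy_davenport _ _ r0 _); last lia.
  by rewrite cF cY -/(rep Z X u); lia.
have : (p * (k - 1) + (p + 1 - k) * minn p (k + k - (p + 1 - k))
    <= #|Limage X Y Z|)%N.
  rewrite card_fibers; apply: leq_trans (leq_sum _ (fun u _ => fiber_ge u)).
  rewrite big_split /= sum_nat_const cF leq_add2l.
  by have := pollard Z X (p + 1 - k); rewrite cX cZ cF; apply; lia.
move: #|Limage X Y Z| => N leN; rewrite ge_min; apply/orP.
(* The condition [2 * p + 1 <= 3 * k] says that [p <= k + k - (p + 1 - k)]. *)
have [k3|k3] := leqP (2 * p + 1) (3 * k); [right|left]; nia.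
Qed.
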